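(* Let $G$ be a finite non-abelian group. Then $G$ is an F-group if and only if for any pair of non-central elements $x,y\in G$ such that $C_G(x)\neq C_G(y)$ one has $Z(C_G(x))\cap Z(C_G(y))=Z(G)$.
   Context: $C_G(x)$ denotes the centraliser of $x$ in $G$ and $Z(H)$ the centre of a group $H$. A finite group $G$ is an F-group if the centraliser of a non-central element never properly contains the centraliser of another non-central element; that is, there are no $x,y\in G\setminus Z(G)$ with $C_G(x)<C_G(y)$ (proper containment). *)

(* Defs.v *)
From mathcomp Require Import all_boot all_fingroup all_solvable.

Set Implicit Arguments.
Unset Strict Implicit.
Unset Printing Implicit Defensive.

Import GroupScope.

Definition F_group (gT : finGroupType) (G : {group gT}) : Prop :=
  ~ exists x y : gT,
      [/\ x \in G :\: 'Z(G), y \in G :\: 'Z(G) & 'C_G[x] \proper 'C_G[y]].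

(* Main.v *)
Require Import Defs.
From mathcomp Require Import all_boot all_fingroup all_solvable.

Set Implicit Arguments.
Unset Strict Implicit.
Unset Printing Implicit Defensive.

Import GroupScope.

(* Membership of z in Z(C_G(x)) is the inclusion of C_G(x) in C_G(z), so a
   non-central z in Z(C_G(x)) and Z(C_G(y)) is exactly a non-central element
   whose centraliser contains both C_G(x) and C_G(y). *)

Lemma mem_center_cent1 (gT : finGroupType) (G : {group gT}) (x z : gT) :
  x \in G -> z \in G -> (z \in 'Z('C_G[x])) = ('C_G[x] \subset 'C_G[z]).
Proof.
move=> Gx Gz; rewrite subsetI subsetIl /= sub_cent1 in_setI.
(* Since [x] lies in its own centraliser, whatever centralises ['C_G[x]] commutes with [x]. *)
apply: andb_idl => cz; rewrite inE Gz /= cent1C.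
by move/centP: cz => cz; apply/cent1P/commute_sym/cz; rewrite inE Gx cent1id.
Qed.

Theorem lemma2p6 (gT : finGroupType) (G : {group gT}) (nabG : ~~ abelian G) :
  F_group G <->
  (forall x y : gT, x \in G :\: 'Z(G) -> y \in G :\: 'Z(G) ->
     'C_G[x] <> 'C_G[y] ->
     'Z('C_G[x]) :&: 'Z('C_G[y]) = 'Z(G)).
Proof.
split=> [FG x y nZx nZy neq_xy | ZI [x [y [nZx nZy /andP[sxy nsyx]]]]].
  have [/setDP[Gx _] /setDP[Gy _]] := (nZx, nZy).
  apply/eqP; rewrite eqEsubset; apply/andP; split; apply/subsetP=> z.
    case/setIP=> Zxz Zyz; apply: contraT => nZz.
    have Gz : z \in G by case/setIP: Zxz => /setIP[].
    (* The F-group condition forbids a strict inclusion between ['C_G[t]] and ['C_G[z]], as [z] is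
       non-central. *)
    have cent_eq t : t \in G :\: 'Z(G) -> z \in 'Z('C_G[t]) ->
        'C_G[t] = 'C_G[z].
      move=> nZt; have /setDP[Gt _] := nZt.
      rewrite mem_center_cent1 // subEproper => /predU1P[] // ltz.
      by case: FG; exists t, z; split=> //; apply/setDP.
    by case: neq_xy; rewrite (cent_eq x) // (cent_eq y).
  case/setIP=> Gz cGz; rewrite in_setI !mem_center_cent1 //.
  (* Centralising [G] implies centralising each subgroup ['C_G[x]], ['C_G[y]]. *)
  by rewrite !subsetI !subsetIl !sub_cent1 !(subsetP (centS (subsetIl _ _)) z).
have [/setDP[Gx _] /setDP[Gy /negP[]]] := (nZx, nZy).
(* The larger centraliser yields the contradiction: [y] lies in both centres, hence would be central
   in [G]. *)
rewrite -(ZI x y) //; last by move=> eq_xy; rewrite eq_xy subxx in nsyx.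
by rewrite in_setI !mem_center_cent1 // sxy subxx.
Qed.
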